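(* Let the problem data $m,\Delta,g,\omega,\xi,\underline{\gamma},\overline{\gamma},\theta,\delta,t,l,(c_i,d_i,\rho_i,\eta_i)_{i=1}^{l},\overline{r}_0,\overline{v}_0,\overline{r}_f,\overline{v}_f,\overline{u}_f$, the sets $\mathbb{H}_i,\mathbb{V},\mathbb{U}_a,\mathbb{U}_b,\mathbb{W}$, and the optimization problems (N) (nonconvex corridor constraints) and (T) (time-triggered corridor constraints, depending on $\tau_1,\ldots,\tau_l$) be as defined in the context. Suppose that problem (N) is feasible, let $\hat u_{[0,t]}$ be an optimal thrust trajectory for (N), and let $\hat r_{[0,t]},\hat v_{[0,t]}$ be position and velocity trajectories which together with $\hat u_{[0,t]}$ satisfy the constraints of (N). Suppose that $\tau_1,\tau_2,\ldots,\tau_l\in\mathbb{R}_+$ are such that $t=\sum_{j=1}^{l}\tau_j$ and $$\hat r_k\in\mathbb{H}_i\quad\text{for all } i\in\{1,\ldots,l\}\text{ and all integers } k\in\Big[\sum_{j=1}^{i-1}\tau_j,\ \sum_{j=1}^{i}\tau_j\Big],$$ where $\sum_{j=1}^{0}\tau_j:=0$. Consider problem (T) with these values $\tau_1,\ldots,\tau_l$. If $u^\star_{[0,t]}$ is an optimal thrust trajectory for (T), then $u^\star_{[0,t]}$ is an optimal thrust trajectory for (N).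
   Context: Notation: $\mathbb{R}_+$ is the set of nonnegative reals, $\mathbb{N}$ the set of positive integers, $\|\cdot\|$ the Euclidean norm, $\langle\cdot,\cdot\rangle$ the standard inner product on $\mathbb{R}^3$, and $[u]_3$ the third entry of $u\in\mathbb{R}^3$. For vectors $a_0,\ldots,a_t\in\mathbb{R}^3$, $a_{[0,t]}$ denotes the stacked vector $(a_0,\ldots,a_t)$. The index $k$ always ranges over integers; $k\in[a,b]$ means that $k$ is an integer with $a\le k\le b$. Data: $m>0$ (mass), $\Delta>0$ (time step), $g=(0,0,-9.81)^\top$, $\omega\in\mathbb{R}_+$ (weight), $\xi,\underline{\gamma},\overline{\gamma},\delta\in\mathbb{R}_+$, $\theta\in[0,\pi/2]$, $t\in\mathbb{N}$ (trajectory length), $l\in\mathbb{N}$ (number of corridors); for each $i\in\{1,\ldots,l\}$: $c_i\in\mathbb{R}^3$, $d_i\in\mathbb{R}^3$ with $\|d_i\|=1$, $\rho_i,\eta_i\in\mathbb{R}_+$; and $\overline{r}_0,\overline{v}_0,\overline{r}_f,\overline{v}_f,\overline{u}_f\in\mathbb{R}^3$ (initial position and velocity; final position, velocity and thrust). Sets: $$\mathbb{H}_i=\{c_i+r\in\mathbb{R}^3 : \|r-\langle d_i,r\rangle d_i\|\le\rho_i,\ |\langle d_i,r\rangle|\le\eta_i\},\qquad \mathbb{V}=\{v\in\mathbb{R}^3:\|v\|\le\xi\},$$ $$\mathbb{U}_a=\{u\in\mathbb{R}^3:\|u\|\le\overline{\gamma},\ \cos\theta\,\|u\|\le[u]_3\},\qquad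 \mathbb{U}_b=\{u\in\mathbb{R}^3:[u]_3\ge\underline{\gamma}\},\qquad \mathbb{W}=\{w\in\mathbb{R}^3:\|w\|\le\delta\}.$$ Both problems minimize over thrust trajectories $u_{[0,t]}$, $u_k\in\mathbb{R}^3$ (with associated positions $r_k\in\mathbb{R}^3$ and velocities $v_k\in\mathbb{R}^3$, $k\in[0,t]$, linked to $u_{[0,t]}$ by the constraints), the objective $$\frac12\sum_{k=0}^{t}\|u_k\|^2+\frac{\omega}{2}\sum_{k=0}^{t-1}\|u_{k+1}-u_k\|^2 .$$ Constraints common to both problems: $$r_{k+1}=r_k+\Delta v_k+\frac{\Delta^2}{3m}\Big(u_k+\frac12u_{k+1}\Big)+\frac{\Delta^2}{2}g,\qquad v_{k+1}=v_k+\frac{\Delta}{2m}(u_k+u_{k+1})+\Delta g,\qquad u_{k+1}-u_k\in\mathbb{W},\qquad k\in[0,t-1],$$ $$u_k\in\mathbb{U}_a\cap\mathbb{U}_b,\quad v_k\in\mathbb{V},\quad k\in[0,t],$$ $$r_0=\overline{r}_0,\quad v_0=\overline{v}_0,\quad r_t=\overline{r}_f,\quad v_t=\overline{v}_f,\quad u_t=\overline{u}_f.$$ Problem (N) (trajectory optimization with nonconvex corridor constraints) has the common constraints together with $r_k\in\bigcup_{i=1}^{l}\mathbb{H}_i$ for all $k\in[0,t]$. Problem (T) (trajectory optimization with time-triggered corridor constraints), for given $\tau_1,\ldots,\tau_l\in\mathbb{R}_+$ with $\sum_{j=1}^{l}\tau_j=t$, has the common constraints together with $r_k\in\mathbb{H}_i$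 for all $k\in[\sum_{j=1}^{i-1}\tau_j,\sum_{j=1}^{i}\tau_j]$ and all $i\in\{1,\ldots,l\}$ (with $\sum_{j=1}^{0}\tau_j:=0$). A problem is feasible if its constraints can be satisfied. A thrust trajectory is optimal for a problem if it satisfies the constraints (together with its associated positions and velocities) and attains the minimum of the objective over all feasible thrust trajectories. *)

(* Defs.v *)
From HB Require Import structures.
From mathcomp Require Import all_boot all_order all_algebra.
From mathcomp Require Import all_classical all_reals all_analysis.

Set Implicit Arguments.
Unset Strict Implicit.
Unset Printing Implicit Defensive.

Import Order.TTheory GRing.Theory Num.Theory.

Local Open Scope classical_set_scope.
Local Open Scope ring_scope.

Definition inner (R : realType) (x y : 'cV[R]_3) : R := \sum_i x i 0 * y i 0.

(* The canonical norm on matrices is the max norm, hence this definition. *)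
Definition enorm (R : realType) (x : 'cV[R]_3) : R := Num.sqrt (inner x x).

Definition third (R : realType) (x : 'cV[R]_3) : R := x ord_max 0.

Definition gravity (R : realType) : 'cV[R]_3 :=
  \col_(i < 3) (if i == ord_max then - (981%:R / 100%:R) else 0).

(* Corridors are indexed from 0, by 'I_ncorr. *)
Record problem_data (R : realType) := ProblemData {
  mass : R;
  dt : R;
  weight : R;
  vmax : R;                      (* xi *)
  thrust_lb : R;                 (* underlined gamma *)
  thrust_ub : R;                 (* overlined gamma *)
  angle : R;                     (* theta *)
  thrust_rate : R;               (* delta *)
  horizon : nat;                 (* t *)
  ncorr : nat;                   (* l *)
  center : 'I_ncorr -> 'cV[R]_3;
  direction : 'I_ncorr -> 'cV[R]_3;
  radius : 'I_ncorr -> R;        (* rho *)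
  halflength : 'I_ncorr -> R;    (* eta *)
  pos_init : 'cV[R]_3;
  vel_init : 'cV[R]_3;
  pos_final : 'cV[R]_3;
  vel_final : 'cV[R]_3;
  thrust_final : 'cV[R]_3;
  mass_gt0 : 0 < mass;
  dt_gt0 : 0 < dt;
  weight_ge0 : 0 <= weight;
  vmax_ge0 : 0 <= vmax;
  thrust_lb_ge0 : 0 <= thrust_lb;
  thrust_ub_ge0 : 0 <= thrust_ub;
  angle_range : 0 <= angle <= pi / 2;
  thrust_rate_ge0 : 0 <= thrust_rate;
  horizon_gt0 : (0 < horizon)%N;
  ncorr_gt0 : (0 < ncorr)%N;
  direction_unit : forall i, enorm (direction i) = 1;
  radius_ge0 : forall i, 0 <= radius i;
  halflength_ge0 : forall i, 0 <= halflength i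
}.

Section Problems.
Variables (R : realType) (D : problem_data R).
Local Notation t := (horizon D).
Local Notation m := (mass D).
Local Notation Delta := (dt D).
Local Notation g := (gravity R).

Definition corridor (i : 'I_(ncorr D)) : set 'cV[R]_3 :=
  [set center i + r | r in
    [set r | enorm (r - inner (direction i) r *: direction i) <= radius i
             /\ `|inner (direction i) r| <= halflength i]].

Definition velocity_set : set 'cV[R]_3 := [set v | enorm v <= vmax D].

Definition thrust_set_a : set 'cV[R]_3 :=
  [set u | enorm u <= thrust_ub D /\ cos (angle D) * enorm u <= third u].

Definition thrust_set_b : set 'cV[R]_3 := [set u | thrust_lb D <= third u].

Definition thrust_rate_set : set 'cV[R]_3 := [set w | enorm w <= thrust_rate D].

Definition trajectory := 'I_t.+1 -> 'cV[R]_3.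

(* For k in [0, t-1], these are the indices k and k+1 of a trajectory. *)
Definition idx_cur (k : 'I_t) : 'I_t.+1 := widen_ord (leqnSn t) k.
Definition idx_next (k : 'I_t) : 'I_t.+1 := lift ord0 k.

Definition objective (u : trajectory) : R :=
  2^-1 * (\sum_(k < t.+1) enorm (u k) ^+ 2)
  + weight D / 2 * (\sum_(k < t) enorm (u (idx_next k) - u (idx_cur k)) ^+ 2).

Record common_constraints (u r v : trajectory) : Prop := CommonConstraints {
  position_dynamics : forall k : 'I_t,
    r (idx_next k) = r (idx_cur k) + Delta *: v (idx_cur k)
      + (Delta ^+ 2 / (3 * m)) *: (u (idx_cur k) + 2^-1 *: u (idx_next k))
      + (Delta ^+ 2 / 2) *: g;
  velocity_dynamics : forall k : 'I_t,
    v (idx_next k) = v (idx_cur k) + (Delta / (2 * m)) *: (u (idx_cur k) + u (idx_next k))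
      + Delta *: g;
  thrust_rate_bound : forall k : 'I_t,
    thrust_rate_set (u (idx_next k) - u (idx_cur k));
  thrust_bound : forall k : 'I_t.+1, (thrust_set_a `&` thrust_set_b) (u k);
  velocity_bound : forall k : 'I_t.+1, velocity_set (v k);
  position_start : r ord0 = pos_init D;
  velocity_start : v ord0 = vel_init D;
  position_end : r ord_max = pos_final D;
  velocity_end : v ord_max = vel_final D;
  thrust_end : u ord_max = thrust_final D
}.

Definition nonconvex_constraints (u r v : trajectory) : Prop :=
  common_constraints u r v
  /\ forall k : 'I_t.+1, (\bigcup_(i in [set: 'I_(ncorr D)]) corridor i) (r k).

(* With 0-based corridors, corridor i is active on the time interval
   [\sum_(j < i) tau j, \sum_(j <= i) tau j]. *)
Definition in_time_corridors (tau : 'I_(ncorr D) -> R) (r : trajectory) : Prop :=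
  forall (i : 'I_(ncorr D)) (k : 'I_t.+1),
    \sum_(j < ncorr D | (j < i)%N) tau j <= k%:R
      <= \sum_(j < ncorr D | (j <= i)%N) tau j ->
    corridor i (r k).

Definition time_triggered_constraints (tau : 'I_(ncorr D) -> R)
    (u r v : trajectory) : Prop :=
  common_constraints u r v /\ in_time_corridors tau r.

Definition feasible_thrust (P : trajectory -> trajectory -> trajectory -> Prop)
    (u : trajectory) : Prop :=
  exists r v, P u r v.

Definition feasible (P : trajectory -> trajectory -> trajectory -> Prop) : Prop :=
  exists u, feasible_thrust P u.

Definition optimal (P : trajectory -> trajectory -> trajectory -> Prop)
    (u : trajectory) : Prop :=
  feasible_thrust P u
  /\ forall u', feasible_thrust P u' -> objective u <= objective u'.

End Problems.

(* Main.v *)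
(* The intervals [\sum_(j < i) tau j, \sum_(j <= i) tau j] cover [0, t], so every
   point of (T) is a point of (N); since u_hat is optimal for (N) and feasible
   for (T), u_star costs at most as much as u_hat, the optimal value of (N). *)

Require Import Defs.
From HB Require Import structures.
From mathcomp Require Import all_boot all_order all_algebra.
From mathcomp Require Import all_classical all_reals all_analysis.

Import Order.TTheory GRing.Theory Num.Theory.

Local Open Scope ring_scope.

(** Take the least [i] whose partial sum through [i] reaches [x]; one exists because the full sum
    does. By minimality the sum stopping just before [i] cannot exceed [x]. *)
Lemma partial_sum_cover (R : realDomainType) (n : nat) (tau : 'I_n -> R) (x : R) :
  (0 < n)%N -> 0 <= x <= \sum_j tau j ->
  exists i : 'I_n, \sum_(j < n | (j < i)%N) tau j <= x
                     <= \sum_(j < n | (j <= i)%N) tau j.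
Proof.
case: n tau => // n tau _ /andP[x_ge0 x_le].
have max_reached : x <= \sum_(j < n.+1 | (j <= @ord_max n)%N) tau j.
  by under eq_bigl => j do rewrite leq_ord.
case: (@arg_minnP _ ord_max (fun i : 'I_n.+1 =>
  x <= \sum_(j < n.+1 | (j <= i)%N) tau j) val max_reached) => i x_le_i i_min.
exists i; rewrite x_le_i andbT.
(* At index 0 the lower sum is empty and [0 <= x] suffices. At [i.+1] the condition [j < i.+1] is
   convertible to [j <= i], so the lower sum is the upper sum of the preceding index, which would
   contradict minimality if it reached [x]. *)
case: i => [[|i] lt_i] /= in x_le_i i_min *; first by rewrite big_pred0.
rewrite leNgt; apply/negP => /ltW x_le_pred.
by have /= := i_min (Ordinal (ltnW lt_i)) x_le_pred; rewrite ltnn.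
Qed.

Lemma time_triggered_nonconvex (R : realType) (D : problem_data R)
    (tau : 'I_(ncorr D) -> R) (u r v : trajectory D) :
  (horizon D)%:R = \sum_j tau j ->
  time_triggered_constraints tau u r v -> nonconvex_constraints u r v.
Proof.
move=> tau_sum [common_urv corridors_r]; split=> // k.
have k_range : 0 <= (k%:R : R) <= \sum_j tau j.
  by rewrite -tau_sum ler0n ler_nat leq_ord.
have [i k_i] := partial_sum_cover _ _ _ _ (ncorr_gt0 D) k_range.
by exists i => //; apply: corridors_r k_i.
Qed.

Theorem proposition1 (R : realType) (D : problem_data R)
    (N_feasible : feasible (@nonconvex_constraints R D))
    (u_hat r_hat v_hat : trajectory D)
    (u_hat_optimal : optimal (@nonconvex_constraints R D) u_hat)
    (hat_constraints : nonconvex_constraints u_hat r_hat v_hat)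
    (tau : 'I_(ncorr D) -> R)
    (tau_ge0 : forall j, 0 <= tau j)
    (tau_sum : (horizon D)%:R = \sum_j tau j)
    (hat_corridors : in_time_corridors tau r_hat)
    (u_star : trajectory D)
    (u_star_optimal : optimal (time_triggered_constraints tau) u_star) :
  optimal (@nonconvex_constraints R D) u_star.
Proof.
have [[r [v star_constraints]] u_star_min] := u_star_optimal.
have [_ u_hat_min] := u_hat_optimal.
have [hat_common _] := hat_constraints.
split=> [|u u_feasible].
  by exists r, v; apply: time_triggered_nonconvex tau_sum star_constraints.
apply: le_trans (u_hat_min u u_feasible).
(* The hat trajectories witness that [u_hat] is feasible for (T): the common constraints come from
   (N), the timed corridors from [hat_corridors]. *)
by apply: u_star_min; exists r_hat, v_hat.
Qed.
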